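(* If $k,\ell>1$ are integers, then $$\gamma_{gr}^{t}(P_k\times P_\ell)=\begin{cases} k\ell, & k,\ell \text{ even},\\ k(\ell-1), & k \text{ even},\ \ell \text{ odd},\\ (k-1)(\ell-1), & k,\ell\text{ odd}.\end{cases}$$ If $k>1$ and $\ell>2$ are integers, then $$\gamma_{gr}^{t}(P_k\times C_\ell)=\begin{cases} k(\ell-2), & k,\ell \text{ even},\\ k(\ell-1), & k \text{ even},\ \ell \text{ odd},\\ (k-1)(\ell-2), & k\text{ odd},\ \ell\text{ even},\\ (k-1)(\ell-1), & k,\ell\text{ odd}.\end{cases}$$
   Context: $P_n$ and $C_n$ denote the path and the cycle on $n$ vertices. $N(v)$ denotes the open neighborhood of $v$. A sequence $(v_1,\ldots,v_m)$ of distinct vertices of a graph $G$ is a (legal) open neighborhood sequence if $N(v_i)\setminus\bigcup_{j=1}^{i-1}N(v_j)\neq\emptyset$ for each $i$. The Grundy total domination number $\gamma_{gr}^{t}(G)$ is the maximum length of a legal open neighborhood sequence of $G$. The direct product $G\times H$ has vertex set $V(G)\times V(H)$, and $(g_1,h_1)$, $(g_2,h_2)$ are adjacent iff $g_1g_2\in E(G)$ and $h_1h_2\in E(H)$. *)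

(* Defs.v *)
From HB Require Import structures.
From mathcomp Require Import all_boot.

Set Implicit Arguments.
Unset Strict Implicit.
Unset Printing Implicit Defensive.

Record sgraph := SGraph {
  vertex :> finType;
  adj : rel vertex;
  adj_sym : symmetric adj;
  adj_irr : irreflexive adj }.

Definition open_nbhd (G : sgraph) (v : G) : {set G} := [set w | adj v w].

Definition legal_seq (G : sgraph) (m : nat) (s : m.-tuple G) : bool :=
  uniq s &&
  [forall i : 'I_m,
    open_nbhd (tnth s i) :\: \bigcup_(j < m | j < i) open_nbhd (tnth s j)
      != set0].

(* The bound #|G| on the length loses nothing, the vertices being distinct:
   see legal_seq_leq_grundy and grundy_attained below. *)
Definition grundy_total (G : sgraph) : nat :=
  \max_(m < #|G|.+1 | [exists s : m.-tuple G, legal_seq s]) m.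

Lemma legal_seq_leq_grundy (G : sgraph) (m : nat) (s : m.-tuple G) :
  legal_seq s -> m <= grundy_total G.
Proof.
move=> ls; have /andP[us _] := ls.
have lem : m < #|G|.+1.
  by rewrite ltnS -(size_tuple s) -(card_uniqP us) max_card.
apply: (@leq_bigmax_cond _ _ (fun i : 'I_(#|G|.+1) => i : nat) (Ordinal lem)).
by apply/existsP; exists s.
Qed.

Lemma grundy_attained (G : sgraph) :
  exists s : (grundy_total G).-tuple G, legal_seq s.
Proof.
pose P (m : 'I_(#|G|.+1)) := [exists s : m.-tuple G, legal_seq s].
have P0 : P ord0.
  apply/existsP; exists [tuple]; apply/andP; split=> //.
  by apply/forallP => -[].
have cP : 0 < #|P| by apply/card_gt0P; exists ord0.
have [m Pm] := eq_bigmax_cond (fun i : 'I_(#|G|.+1) => i : nat) cP.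
by rewrite /grundy_total => ->; apply/existsP.
Qed.

Definition path_adj (n : nat) : rel 'I_n :=
  fun i j => (i.+1 == j) || (j.+1 == i).

Lemma path_adj_sym n : symmetric (@path_adj n).
Proof. by move=> i j; rewrite /path_adj orbC. Qed.

Lemma path_adj_irr n : irreflexive (@path_adj n).
Proof. by move=> i; rewrite /path_adj orbb gtn_eqF. Qed.

Definition path_graph (n : nat) : sgraph :=
  SGraph (@path_adj_sym n) (@path_adj_irr n).

(* The conjunct i != j only matters for n = 1; C_n is meant for n > 2. *)
Definition cycle_adj (n : nat) : rel 'I_n :=
  fun i j => (i != j) && ((ordS i == j) || (ordS j == i)).

Lemma cycle_adj_sym n : symmetric (@cycle_adj n).
Proof. by move=> i j; rewrite /cycle_adj eq_sym orbC. Qed.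

Lemma cycle_adj_irr n : irreflexive (@cycle_adj n).
Proof. by move=> i; rewrite /cycle_adj eqxx. Qed.

Definition cycle_graph (n : nat) : sgraph :=
  SGraph (@cycle_adj_sym n) (@cycle_adj_irr n).

Section DirectProduct.
Variables G H : sgraph.

Definition dprod_adj : rel (G * H)%type :=
  fun x y => adj x.1 y.1 && adj x.2 y.2.

Lemma dprod_adj_sym : symmetric dprod_adj.
Proof. by move=> x y; rewrite /dprod_adj adj_sym (adj_sym x.2). Qed.

Lemma dprod_adj_irr : irreflexive dprod_adj.
Proof. by move=> x; rewrite /dprod_adj adj_irr. Qed.

Definition dprod_graph : sgraph := SGraph dprod_adj_sym dprod_adj_irr.

End DirectProduct.

(* Main.v *)
Require Import Defs.
From HB Require Import structures.
From mathcomp Require Import all_boot.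
From mathcomp Require Import all_algebra zify.

(** Upper bound: the vertices of a legal sequence and the vertices they
    footprint index a unitriangular submatrix of the adjacency matrix, so the
    Grundy total domination number is at most the rank of that matrix over any
    field.  The adjacency matrix of [G x H] is a Kronecker product, so its rank
    is the product of the two ranks.  Over [F_2] the ranks are [n] or [n - 1]
    for [P_n] and [n - 2] or [n - 1] for [C_n], for [n] even or odd
    respectively; over the rationals [C_n] can have full rank, which would be
    too weak.

    Lower bound: two legal sequences combine lexicographically into one of the
    direct product, and an induced path with [m] vertices, [m] even, carries a
    legal sequence of length [m]. *)

Set Implicit Arguments.
Unset Strict Implicit.
Unset Printing Implicit Defensive.

Import GRing.Theory.

(** * Upper bounds from spanning rows *)

(** Stands in for the adjacency matrix having rank at most [#|T|]. *)
Definition rows_span (F : fieldType) (G : sgraph) (T : {set G}) : Prop :=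
  exists X : G -> G -> F, forall u v : G,
    ((adj u v)%:R = \sum_(t in T) X u t * (adj t v)%:R :> F)%R.

Lemma rows_spanT (F : fieldType) (G : sgraph) : rows_span F [set: G].
Proof.
exists (fun u t => (u == t)%:R)%R => u v.
rewrite (bigD1 u) ?inE //= eqxx mul1r big1 ?addr0 // => t /andP[_ tu].
by rewrite eq_sym (negPf tu) mul0r.
Qed.

Lemma grundy_leq_span (F : fieldType) (G : sgraph) (T : {set G}) :
  rows_span F T -> grundy_total G <= #|T|.
Proof.
case=> X adjE; have [s /andP[_ /forallP ls]] := grundy_attained G.
set m := grundy_total G in s ls *.
have [w sw] : exists w : 'I_m -> G, forall i, adj (tnth s i) (w i) /\
    forall j : 'I_m, j < i -> ~~ adj (tnth s j) (w i).
  pose P i x := x \in open_nbhd (tnth s i) :\: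
    \bigcup_(j < m | j < i) open_nbhd (tnth s j).
  have exP i : exists x, P i x by apply/set0Pn/ls.
  exists (fun i => xchoose (exP i)) => i.
  have := xchooseP (exP i); rewrite /P !inE => /andP[/bigcupP nU ->].
  split=> // j ji; apply/negP => a; apply: nU; exists j => //.
  by rewrite inE.
pose M : 'M[F]_m := (\matrix_(i, j) (adj (tnth s i) (w j))%:R)%R.
pose A : 'M[F]_(m, #|T|) := (\matrix_(i, j) X (tnth s i) (enum_val j))%R.
pose B : 'M[F]_(#|T|, m) := (\matrix_(i, j) (adj (enum_val i) (w j))%:R)%R.
(* [M] factors through [#|T|] coordinates, yet is lower triangular with unit diagonal, so its full
   rank [m] is at most [#|T|]. *)
have ME : M = (A *m B)%R.
  apply/matrixP => i j; rewrite !mxE adjE big_enum_val /=.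
  by apply: eq_bigr => t _; rewrite !mxE.
have Mtrig : is_trig_mx M.
  apply/is_trig_mxP => i j ij; rewrite mxE.
  by have [_ /(_ _ ij)/negPf->] := sw j.
have Mfull : \rank M = m.
  apply/eqP; rewrite -[_ == _]/(row_free M) row_free_unit unitmxE det_trig //.
  rewrite big1 ?unitr1 // => i _; rewrite mxE.
  by have [-> _] := sw i.
by rewrite -Mfull ME (leq_trans (mxrankM_maxl _ _)) ?rank_leq_col.
Qed.

(** The adjacency indicator of the product is the product of the indicators, so the coefficients
    multiply. *)
Lemma rows_span_dprod (F : fieldType) (G H : sgraph)
    (T : {set G}) (U : {set H}) :
  rows_span F T -> rows_span F U ->
  rows_span F (setX T U : {set dprod_graph G H}).
Proof.
case=> X XE [Y YE]; exists (fun u t => X u.1 t.1 * Y u.2 t.2)%R => u v.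
rewrite /= /dprod_adj -mulnb natrM XE YE big_distrlr pair_big /=.
apply: eq_big => [[a b]|[a b] _] /=; first by rewrite !inE.
by rewrite -mulnb natrM mulrACA.
Qed.

(* Over [F_2], [K u] is the support of a vector in the left kernel. *)
Lemma even_cover_span (G : sgraph) (T : {set G}) (K : G -> {set G}) :
  (forall u, u \notin T -> K u :\: T = [set u]) ->
  (forall u v, u \notin T -> ~~ odd #|K u :&: open_nbhd v|) ->
  rows_span 'F_2 T.
Proof.
move=> KT Keven.
exists (fun u t => if u \in T then (u == t)%:R else (t \in K u)%:R)%R => u v.
case: (boolP (u \in T)) => /= uT.
  rewrite (bigD1 u) //= eqxx mul1r big1 ?addr0 // => t /andP[_ tu].
  by rewrite eq_sym (negPf tu) mul0r.
have F2 (x : 'F_2) : (x + x = 0)%R.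
  by rewrite -mulr2n -mulr_natl (_ : 2%:R = 0)%R ?mul0r //; apply/val_inj.
(* Evenly many neighbours of [v] lie in [K u], so the rows of [K u] sum to zero. Only [u] in [K u]
   is outside [T], so row [u] is the sum of the others. *)
have K0 : (\sum_(t in K u) (adj t v)%:R = 0 :> 'F_2)%R.
  rewrite (bigID (fun t => t \in open_nbhd v)) /= [X in (_ + X)%R]big1 ?addr0.
    rewrite (eq_bigr (fun=> 1%R)) => [|t /andP[_]]; last first.
      by rewrite inE adj_sym => ->.
    rewrite sumr_const.
    have -> : #|[pred t | (t \in K u) && (t \in open_nbhd v)]|
              = #|K u :&: open_nbhd v| by apply: eq_card => t; rewrite !inE.
    rewrite -[#|_|]odd_double_half (negPf (Keven u v uT)) add0n.
    by rewrite -mul2n mulrnA mulr2n F2 mul0rn.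
  by move=> t /andP[_]; rewrite inE adj_sym => /negPf->.
rewrite (big_setID T) /= (KT _ uT) big_set1 in K0.
have -> : ((adj u v)%:R = \sum_(t in K u :&: T) (adj t v)%:R :> 'F_2)%R.
  by apply: (addIr (adj u v)%:R%R); rewrite F2 K0.
rewrite [RHS](eq_bigr (fun t => if t \in K u then (adj t v)%:R else 0)%R).
  by rewrite -big_mkcondr; apply: eq_bigl => t; rewrite inE andbC.
by move=> t _; case: ifP; rewrite ?mul1r ?mul0r.
Qed.

(** * Lower bounds from footprinted vertices *)

(** A legal sequence [s] with a vertex [w i] footprinted by each [s i]; values from [m] on are
    arbitrary. *)
Definition triangular (G : sgraph) (m : nat) (s w : nat -> G) : Prop :=
  (forall i, i < m -> adj (s i) (w i)) /\
  (forall i j, j < i < m -> ~~ adj (s j) (w i)).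

Lemma triangular_leq_grundy (G : sgraph) (m : nat) (s w : nat -> G) :
  triangular m s w -> m <= grundy_total G.
Proof.
case=> sw nsw; apply: (@legal_seq_leq_grundy G m [tuple s i | i < m]).
apply/andP; split.
  (* Distinctness is automatic: a repeated vertex would already be adjacent to what its later copy
     footprints. *)
  rewrite map_inj_uniq ?enum_uniq // => i j sij; apply/val_inj => /=.
  have [ij|ji|//] := ltngtP i j.
    by have := nsw j i; rewrite ij ltn_ord sij sw // => /(_ isT).
  by have := nsw i j; rewrite ji ltn_ord -sij sw // => /(_ isT).
apply/forallP => i; apply/set0Pn; exists (w i).
rewrite !inE tnth_mktuple sw // andbT; apply/bigcupP => -[j ji].
by rewrite inE tnth_mktuple; apply/negP/nsw; rewrite ji /=.
Qed.

(** An earlier index has a smaller quotient, and adjacency fails in [G], or the same quotient and a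
    smaller remainder, and it fails in [H]. *)
Lemma triangular_dprod (G H : sgraph) (m n : nat)
    (s w : nat -> G) (t x : nat -> H) :
  triangular m s w -> triangular n t x ->
  @triangular (dprod_graph G H) (m * n)
    (fun i => (s (i %/ n), t (i %% n))) (fun i => (w (i %/ n), x (i %% n))).
Proof.
case=> sw nsw [tx ntx]; have [->|n0] := posnP n.
  by rewrite muln0; split=> [//|i j]; rewrite ltn0 andbF.
split=> [i|i j /andP[ji]]; rewrite -ltn_divLR // => im;
    rewrite /= /dprod_adj /=.
  by rewrite sw // tx // ltn_mod.
have [jin|ijn|eqn] := ltngtP (j %/ n) (i %/ n).
- by rewrite negb_and nsw // jin.
- by have := leq_div2r n (ltnW ji); rewrite leqNgt ijn.
- rewrite negb_and (ntx (i %% n)) ?orbT // ltn_mod n0 andbT.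
  by move: ji; rewrite {1}(divn_eq j n) {1}(divn_eq i n) eqn ltn_add2l.
Qed.

(* Even positions in increasing order footprint their right neighbours, then
   odd positions in decreasing order footprint their left neighbours. *)
Lemma induced_path_triangular (G : sgraph) (m : nat) (f : nat -> G) :
  ~~ odd m ->
  (forall a b, a < m -> b < m ->
     adj (f a) (f b) = (a.+1 == b) || (b.+1 == a)) ->
  triangular m
    (fun i => f (if i < m./2 then i.*2 else (m.-1 - i).*2.+1))
    (fun i => f (if i < m./2 then i.*2.+1 else (m.-1 - i).*2)).
Proof.
move=> m_even fE; split=> [i im|i j /andP[ji im]].
  by case: ifP => ilt; rewrite fE; lia.
(* Within one half the two positions are at least 3 apart; across the halves both are even. *)
by case: ifP => jlt; case: ifP => ilt; rewrite fE; lia.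
Qed.

(** * Paths and cycles *)

Lemma path_triangular (n m : nat) :
  ~~ odd m -> m <= n.+1 -> exists s w, @triangular (path_graph n.+1) m s w.
Proof.
move=> m_even mn; eexists; eexists.
apply: (@induced_path_triangular (path_graph n.+1) m (@inord n)) => // a b am bm.
by rewrite /= /path_adj !inordK // (leq_trans _ mn).
Qed.

(** Removing a vertex from the cycle leaves an induced path on [n] vertices, whence [m <= n]. *)
Lemma cycle_triangular (n m : nat) :
  ~~ odd m -> m <= n -> exists s w, @triangular (cycle_graph n.+1) m s w.
Proof.
move=> m_even mn; eexists; eexists.
apply: (@induced_path_triangular (cycle_graph n.+1) m (@inord n)) => // a b am bm.
rewrite /= /cycle_adj -!val_eqE /= !inordK; try lia.
by rewrite !modn_small; lia.
Qed.

(** Both ends are at even positions, so an odd position has two even neighbours and an even position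
    has none. *)
Lemma path_span (n : nat) : odd n.+1 ->
  @rows_span 'F_2 (path_graph n.+1) [set~ ord_max].
Proof.
move=> n_odd.
apply: (@even_cover_span (path_graph n.+1) _ (fun=> [set i : 'I_n.+1 | ~~ odd i])).
  move=> u; rewrite !inE negbK => /eqP->; apply/setP => i; rewrite !inE negbK.
  by have [->|//] := eqVneq i ord_max.
move=> u v _; have [v_odd|v_even] := boolP (odd v); last first.
  rewrite (_ : _ :&: _ = set0) ?cards0 //; apply/setP => i.
  by rewrite !inE /= /path_adj; lia.
have vn : v < n by have := ltn_ord v; lia.
rewrite (_ : _ :&: _ = [set inord v.-1; inord v.+1]).
  by rewrite cards2 -val_eqE /= !inordK; lia.
apply/setP => i; rewrite !inE /= /path_adj -!val_eqE /= !inordK; lia.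
Qed.

Lemma val_ordS (n : nat) (v : 'I_n.+1) :
  ordS v = (if v == n :> nat then 0 else v.+1) :> nat.
Proof.
rewrite /=; have [->|vn] := eqVneq (v : nat) n; first exact: modnn.
by rewrite modn_small; have := ltn_ord v; lia.
Qed.

Lemma val_ord_pred (n : nat) (v : 'I_n.+1) :
  ord_pred v = (if v == 0 :> nat then n else v.-1) :> nat.
Proof.
rewrite /=; have [->|v0] := eqVneq (v : nat) 0; first exact: modn_small.
rewrite (_ : (v + n.+1).-1 = v.-1 + n.+1); last by lia.
by rewrite modnDr modn_small; have := ltn_ord v; lia.
Qed.

Lemma cycle_nbhd (n : nat) (v : 'I_n.+1) : 1 < n ->
  @open_nbhd (cycle_graph n.+1) v = [set ordS v; ord_pred v].
Proof.
move=> n_gt1; apply/setP => i; rewrite !inE /= /cycle_adj.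
rewrite -!(inj_eq (@ord_inj _)) !val_ordS val_ord_pred /=.
by have := ltn_ord i; have := ltn_ord v; do !case: ifP; lia.
Qed.

Lemma ordS_neq_pred (n : nat) (v : 'I_n.+1) : 1 < n -> ordS v != ord_pred v.
Proof.
move=> n_gt1; rewrite -(inj_eq (@ord_inj _)) val_ordS val_ord_pred.
by have := ltn_ord v; do !case: ifP; lia.
Qed.

(** A cycle is 2-regular, so all its rows sum to zero over ['F_2]. *)
Lemma cycle_span_odd (n : nat) : 1 < n ->
  @rows_span 'F_2 (cycle_graph n.+1) [set~ ord_max].
Proof.
move=> n_gt1.
apply: (@even_cover_span (cycle_graph n.+1) _ (fun=> setT)) => [u|u v _].
  by rewrite !inE negbK => /eqP->; rewrite setTD setCK.
by rewrite setTI cycle_nbhd // cards2 ordS_neq_pred.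
Qed.

(** Parity alternates around the cycle, so each parity class gives its own relation; one vertex of
    each class is dropped. *)
Lemma cycle_span_even (n : nat) : 1 < n -> ~~ odd n.+1 ->
  @rows_span 'F_2 (cycle_graph n.+1) (~: [set ord_max; inord n.-1]).
Proof.
move=> n_gt1 n_even.
have n1E : nat_of_ord (inord n.-1 : 'I_n.+1) = n.-1 by rewrite inordK; lia.
apply: (@even_cover_span (cycle_graph n.+1) _
          (fun u => [set i : 'I_n.+1 | odd i == odd (u : 'I_n.+1)])).
  move=> u; rewrite !inE negbK -!val_eqE /= n1E => uT.
  by apply/setP => i; rewrite !inE negbK -!val_eqE /= n1E; lia.
move=> u v _; rewrite cycle_nbhd //.
have oddS : odd (ordS v) = ~~ odd v by rewrite val_ordS; case: ifP; lia.
have oddP : odd (ord_pred v) = ~~ odd v by rewrite val_ord_pred; case: ifP; lia.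
have [uv|uv] := eqVneq (odd (u : 'I_n.+1)) (odd v).
  rewrite (_ : _ :&: _ = set0) ?cards0 //; apply/setP => i; rewrite !inE uv.
  have [->|_] := eqVneq i (ordS v); first by rewrite oddS; lia.
  have [->|_] := eqVneq i (ord_pred v); first by rewrite oddP; lia.
  by rewrite andbF.
rewrite (setIidPr _) ?cards2 ?ordS_neq_pred //.
by apply/subsetP => i; rewrite !inE => /orP[]/eqP->; rewrite ?oddS ?oddP; lia.
Qed.

(** * Matching the bounds on products *)

Lemma grundy_dprod (F : fieldType) (G H : sgraph) (T : {set G}) (U : {set H})
    (m n : nat) :
  rows_span F T -> rows_span F U -> #|T| = m -> #|U| = n ->
  (exists s w, @triangular G m s w) -> (exists s w, @triangular H n s w) ->
  grundy_total (dprod_graph G H) = m * n.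
Proof.
move=> spanT spanU Tm Un [s [w tri_m]] [t [x tri_n]]; apply/eqP.
rewrite eqn_leq (triangular_leq_grundy (triangular_dprod tri_m tri_n)) andbT.
by rewrite -Tm -Un -cardsX; apply/grundy_leq_span/rows_span_dprod; eassumption.
Qed.

Theorem corollary2p11 :
  (forall k l : nat, 1 < k -> 1 < l ->
     [/\ ~~ odd k -> ~~ odd l ->
           grundy_total (dprod_graph (path_graph k) (path_graph l)) = k * l,
         ~~ odd k -> odd l ->
           grundy_total (dprod_graph (path_graph k) (path_graph l))
             = k * (l - 1)
       & odd k -> odd l ->
           grundy_total (dprod_graph (path_graph k) (path_graph l))
             = (k - 1) * (l - 1)])
  /\
  (forall k l : nat, 1 < k -> 2 < l ->
     [/\ ~~ odd k -> ~~ odd l ->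
           grundy_total (dprod_graph (path_graph k) (cycle_graph l))
             = k * (l - 2),
         ~~ odd k -> odd l ->
           grundy_total (dprod_graph (path_graph k) (cycle_graph l))
             = k * (l - 1),
         odd k -> ~~ odd l ->
           grundy_total (dprod_graph (path_graph k) (cycle_graph l))
             = (k - 1) * (l - 2)
       & odd k -> odd l ->
           grundy_total (dprod_graph (path_graph k) (cycle_graph l))
             = (k - 1) * (l - 1)]).
Proof.
have cardC1 n (x : 'I_n.+1) : #|[set~ x]| = n.+1 - 1.
  by rewrite cardsC1 card_ord subn1.
have cardC2 n : 1 < n -> #|~: [set ord_max; inord n.-1 : 'I_n.+1]| = n.+1 - 2.
  move=> n_gt1; rewrite cardsCs setCK card_ord cards2 -val_eqE /= inordK; lia.
have path_even k l (H : sgraph) (U : {set H}) : ~~ odd k -> 1 < k -> rows_span 'F_2 U ->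
    #|U| = l -> (exists s w, @triangular H l s w) ->
    grundy_total (dprod_graph (path_graph k) H) = k * l.
  case: k => // k k_even _ spanU cardU tri.
  apply: (grundy_dprod (rows_spanT _ _) spanU _ cardU _ tri).
    by rewrite cardsT card_ord.
  exact: path_triangular.
have path_odd k l (H : sgraph) (U : {set H}) : odd k -> rows_span 'F_2 U ->
    #|U| = l -> (exists s w, @triangular H l s w) ->
    grundy_total (dprod_graph (path_graph k) H) = (k - 1) * l.
  case: k => // k k_odd spanU cardU tri.
  apply: (grundy_dprod (path_span k_odd) spanU (cardC1 _ _) cardU _ tri).
  by apply: path_triangular; lia.
split=> k [//|l] k_gt1 l_gt1; split=> k_par l_par.
- apply: (path_even _ _ _ _ k_par k_gt1 (rows_spanT _ _)).
    by rewrite cardsT card_ord.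
  exact: path_triangular.
- apply: (path_even _ _ _ _ k_par k_gt1 (path_span l_par) (cardC1 _ _)).
  by apply: path_triangular; lia.
- apply: (path_odd _ _ _ _ k_par (path_span l_par) (cardC1 _ _)).
  by apply: path_triangular; lia.
- apply: (path_even _ _ _ _ k_par k_gt1 (cycle_span_even l_gt1 l_par)).
    exact: cardC2.
  by apply: cycle_triangular; lia.
- apply: (path_even _ _ _ _ k_par k_gt1 (cycle_span_odd l_gt1) (cardC1 _ _)).
  by apply: cycle_triangular; lia.
- apply: (path_odd _ _ _ _ k_par (cycle_span_even l_gt1 l_par)).
    exact: cardC2.
  by apply: cycle_triangular; lia.
- apply: (path_odd _ _ _ _ k_par (cycle_span_odd l_gt1) (cardC1 _ _)).
  by apply: cycle_triangular; lia.
Qed.
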